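(* Let $n\ge3$ and $\delta\in[0,1)$. If a distribution over permutations of $[n]$ satisfies the $(3,\delta)$-uniform-induced-ordering property, then there is an algorithm for the secretary problem that, for every assignment of distinct values to the items, selects the item of maximum value with probability at least $\frac{(1-\delta)^2}{6(1+\delta)}$.
   Context: $(k,\delta)$-uniform-induced-ordering property of a distribution over permutations $\pi$ of $[n]$ ($\pi(i)$ is the arrival time of item $i$): for every $k$ distinct items $y_1,\dots,y_k$, $\Pr[\pi(y_1)<\dots<\pi(y_k)]\ge(1-\delta)/k!$. Secretary problem: an adversary assigns distinct values to items $[n]$; items arrive in the order $\pi$ drawn from the distribution, independently of the values; an online comparison-based (possibly randomized) algorithm irrevocably decides at each arrival whether to select the current item (at most one selection), based only on the relative order of values seen so far; it succeeds if it selects the maximum-value item. *)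

(* Defs.v *)
From HB Require Import structures.
From mathcomp Require Import all_boot all_order all_algebra all_fingroup.
From mathcomp Require Import reals.
Set Implicit Arguments.
Unset Strict Implicit.
Unset Printing Implicit Defensive.
Import Order.TTheory GRing.Theory Num.Theory.
Local Open Scope ring_scope.

Record fdist (R : realType) (T : finType) := FDist {
  fdist_mass :> {ffun T -> R};
  fdist_ge0 : forall x, 0 <= fdist_mass x;
  fdist_sum1 : \sum_x fdist_mass x = 1 }.

Definition Pr (R : realType) (T : finType) (d : fdist R T) (E : pred T) : R :=
  \sum_(x | E x) d x.

(* p i is the arrival time of item i, so (p^-1)%g t is the item arriving at
   time t. *)
Definition uniform_induced_ordering (R : realType) (n k : nat) (delta : R)
    (mu : fdist R 'S_n) : Prop :=
  forall y : k.-tuple 'I_n, uniq y ->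
    (1 - delta) / k`!%:R
      <= Pr mu (fun p => sorted ltn [seq nat_of_ord (p i) | i <- y]).

(* The relative order of the values seen up to time t: the pairs (s, s') of
   times at most t such that the item arriving at s has a smaller value than
   the item arriving at s'. *)
Definition relative_order (R : realType) (n : nat) (v : 'I_n -> R) (p : 'S_n)
    (t : 'I_n) : {set 'I_n * 'I_n} :=
  [set s : 'I_n * 'I_n | [&& (s.1 <= t)%N, (s.2 <= t)%N &
     v ((p^-1)%g s.1) < v ((p^-1)%g s.2)]].

(* Given the current time and the relative order seen so far, says whether to
   select the current item, provided that none has been selected before. *)
Definition stopping_rule (n : nat) := 'I_n -> {set 'I_n * 'I_n} -> bool.

(* The whole random seed is drawn at the start, independently of the arrival
   order. A finite seed loses no generality, since there are finitely many
   stopping rules. *)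
Record secretary_algorithm (R : realType) (n : nat) := SecretaryAlgorithm {
  seed : finType;
  seed_dist : fdist R seed;
  rule : seed -> stopping_rule n }.

Definition selects (R : realType) (n : nat) (A : stopping_rule n)
    (v : 'I_n -> R) (p : 'S_n) (i : 'I_n) : bool :=
  A (p i) (relative_order v p (p i)) &&
  [forall s : 'I_n, (s < p i)%N ==> ~~ A s (relative_order v p s)].

Definition succeeds (R : realType) (n : nat) (A : stopping_rule n)
    (v : 'I_n -> R) (p : 'S_n) : bool :=
  [exists i, selects A v p i && [forall j, v j <= v i]].

Definition success_probability (R : realType) (n : nat) (mu : fdist R 'S_n)
    (A : secretary_algorithm R n) (v : 'I_n -> R) : R :=
  \sum_(w : seed A) seed_dist A w * Pr mu (succeeds (rule w) v).

(* Main.v *)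
Require Import Defs.
From HB Require Import structures.
From mathcomp Require Import all_boot all_order all_algebra all_fingroup.
From mathcomp Require Import reals.
From mathcomp Require Import lra.
Set Implicit Arguments.
Unset Strict Implicit.
Unset Printing Implicit Defensive.
Import Order.TTheory GRing.Theory Num.Theory.
Local Open Scope ring_scope.

(** Draw a threshold time [w] uniformly and select the first record arriving at
    time [w] or later.  If the second best item [b] arrives before [w] and the
    best item [a] does not, then [a] is selected.  The item [z] arriving at time
    [w] turns "[b] before [w], [a] not before [w]" into the induced ordering
    [b, z, a], so that summing over [w] amounts to summing over items [z].  Each
    [z] other than [a] and [b] contributes at least [(1 - delta) / 6], and [z = a]
    at least [(1 - delta) / 2], which more than makes up for [z = b].  This gives
    the stronger bound [(n + 1) / n * (1 - delta) / 6]. *)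

Lemma exists_notin_seq (T : finType) (s : seq T) :
  (size s < #|T|)%N -> exists x, x \notin s.
Proof.
move=> s_lt; suff /subsetPn[x _ xNs] : ~~ (T \subset s) by exists x.
apply: contraL s_lt => /subset_leq_card T_le.
by rewrite -leqNgt (leq_trans T_le) ?card_size.
Qed.

Lemma count_lt_sorted_cat_cons (d : Order.disp_t) (T : porderType d) (x : T)
    (s1 s2 : seq T) :
  sorted <%O (s1 ++ x :: s2) -> count (< x)%O (s1 ++ s2) = size s1.
Proof.
have s1_lt : (size s1 < size (s1 ++ x :: s2))%N by rewrite size_cat -addn1 leq_add2l.
move=> /(count_lt_nth x)/(_ s1_lt).
by rewrite nth_cat ltnn subnn !count_cat /= ltxx.
Qed.

Section FiniteDistributions.
Variables (R : realType) (T : finType).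
Implicit Types (mu : fdist R T) (E F : pred T).

Lemma Pr_ge0 mu E : 0 <= Pr mu E.
Proof. by apply: sumr_ge0 => x _; exact: fdist_ge0. Qed.

Lemma le_Pr mu E F : subpred E F -> Pr mu E <= Pr mu F.
Proof.
move=> sEF; rewrite /Pr [leLHS]big_mkcond [leRHS]big_mkcond /=.
apply: ler_sum => x _; case: ifP => [/sEF -> //|_].
by case: ifP => // _; exact: fdist_ge0.
Qed.

Lemma Pr_partition (I : finType) (f : T -> I) mu E :
  Pr mu E = \sum_i Pr mu (fun x => E x && (f x == i)).
Proof. by rewrite /Pr (partition_big f xpredT). Qed.

Lemma sum_Pr_reindex (I : finType) (f : T -> I -> I) mu (E : T -> pred I) :
  (forall x, injective (f x)) ->
  \sum_i Pr mu (E^~ i) = \sum_i Pr mu (fun x => E x (f x i)).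
Proof.
move=> inj_f; rewrite /Pr (exchange_big_dep xpredT) //=.
rewrite [RHS](exchange_big_dep xpredT) //=.
by apply: eq_bigr => x _; rewrite (reindex_inj (inj_f x)).
Qed.

Hypothesis T_gt0 : (0 < #|T|)%N.

Let uniform_mass : {ffun T -> R} := [ffun=> #|T|%:R^-1].

Lemma uniform_mass_ge0 x : 0 <= uniform_mass x.
Proof. by rewrite ffunE invr_ge0 ler0n. Qed.

Lemma uniform_mass_sum1 : \sum_x uniform_mass x = 1.
Proof.
under eq_bigr do rewrite ffunE.
by rewrite sumr_const -[_ *+ _]mulr_natr mulVf // pnatr_eq0 -lt0n.
Qed.

Definition fdist_uniform : fdist R T := FDist uniform_mass_ge0 uniform_mass_sum1.

End FiniteDistributions.

Section InducedOrderings.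
Variables (R : realType) (n : nat) (delta : R) (mu : fdist R 'S_n).

(* An additional item can be inserted at k + 1 places of an ordering of k items,
   and the k + 1 resulting orderings exclude each other. *)
Lemma uniform_induced_orderingW (k : nat) : (k < n)%N ->
  uniform_induced_ordering k.+1 delta mu -> uniform_induced_ordering k delta mu.
Proof.
move=> k_lt_n hmu y uniq_y.
have [z zNy] : exists z, z \notin y.
  by apply: exists_notin_seq; rewrite size_tuple card_ord.
pose place (p : 'S_n) : 'I_k.+1 :=
  inord (count (< (p z : nat))%O [seq nat_of_ord (p i) | i <- y]).
rewrite (Pr_partition place).
have -> : (1 - delta) / k`!%:R = \sum_(i < k.+1) (1 - delta) / k.+1`!%:R.
  rewrite sumr_const card_ord -[RHS]mulr_natr factS natrM invfM mulrA mulrAC.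
  by rewrite divfK ?pnatr_eq0.
apply: ler_sum => i _; pose zy := take i y ++ z :: drop i y.
have perm_zy : perm_eq zy (z :: y).
  by rewrite /zy -cat1s perm_catCA /= cat_take_drop.
have size_zy : size zy == k.+1 by rewrite (perm_size perm_zy) /= size_tuple.
apply: le_trans (hmu (Tuple size_zy) _) _.
  by rewrite /= (perm_uniq perm_zy) /= zNy.
apply: le_Pr => p /= sorted_zy; apply/andP; split.
  apply: (subseq_sorted ltn_trans _ sorted_zy); apply: map_subseq.
  by rewrite -[X in subseq X _](cat_take_drop i) cat_subseq ?subseq_cons.
move: sorted_zy; rewrite /zy map_cat /= => /count_lt_sorted_cat_cons.
rewrite -map_cat cat_take_drop size_map size_takel ?size_tuple -1?ltnS //.
by rewrite /place => ->; rewrite inord_val.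
Qed.

Lemma sum_Pr_between (a b : 'I_n) : (3 <= n)%N -> a != b ->
  uniform_induced_ordering 3 delta mu ->
  n.+1%:R * ((1 - delta) / 6%:R) <= \sum_z Pr mu (fun p => (p b < p z <= p a)%N).
Proof.
move=> n_ge3 ab hmu; set c := (1 - delta) / 6%:R.
have before_a : c *+ 3 <= Pr mu (fun p => (p b < p a <= p a)%N).
  have -> : c *+ 3 = (1 - delta) / 2`!%:R by rewrite /c (_ : 2`! = 2) //; lra.
  apply: le_trans (uniform_induced_orderingW n_ge3 hmu (y := [tuple b; a]) _) _.
    by rewrite /= inE eq_sym ab.
  by apply: le_Pr => p; rewrite /= leqnn.
have between z : z != a -> z != b -> c <= Pr mu (fun p => (p b < p z <= p a)%N).
  move=> za zb; apply: le_trans (hmu [tuple b; z; a] _) _.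
    by rewrite /= !inE negb_or eq_sym zb eq_sym ab za.
  by apply: le_Pr => p /= /and3P[-> /ltnW].
have -> : n.+1%:R * c = c *+ 3 + \sum_(z : 'I_n | (z != a) && (z != b)) c.
  have -> : n.+1%:R * c = c + \sum_(z : 'I_n) c.
    by rewrite sumr_const card_ord mulr_natl mulrS.
  by rewrite -[c *+ 3]/(c + (c + c)) (bigD1 a) // (bigD1 b) 1?eq_sym //= !addrA.
rewrite [leRHS](bigD1 a) // [X in _ <= _ + X](bigD1 b) 1?eq_sym //= [leRHS]addrA.
apply: lerD.
  by rewrite -[leLHS]addr0 lerD ?Pr_ge0.
by apply: ler_sum => z /andP[za zb]; exact: between.
Qed.

End InducedOrderings.

Section TopTwo.
Variables (d : Order.disp_t) (T : finType) (U : orderType d).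
Implicit Types (v : T -> U) (a b : T).

Definition top_two v a b := (v b < v a)%O /\ forall j, j != a -> (v j <= v b)%O.

Lemma top_two_lt v a b j : top_two v a b -> j != a -> (v j < v a)%O.
Proof. by move=> [ba maxb] /maxb /le_lt_trans; apply. Qed.

Lemma exists_top_two v : (1 < #|T|)%N -> injective v -> exists a b, top_two v a b.
Proof.
move=> /card_gt1P[x [y [_ _ xy]]] inj_v.
case: (@arg_maxP _ _ _ x xpredT v isT) => a _ maxa.
have [c ca] : exists c, c != a.
  by case: (eqVneq x a) xy => [-> ay|xa _]; [exists y; rewrite eq_sym | exists x].
case: (@arg_maxP _ _ _ c (predC1 a) v ca) => b /= ba maxb.
by exists a, b; split=> //; rewrite lt_neqAle (inj_eq inj_v) ba; exact: maxa.
Qed.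

End TopTwo.

Definition is_record (n : nat) : stopping_rule n :=
  fun t S => [forall s : 'I_n, (s < t)%N ==> ((s, t) \in S)].

Definition threshold_rule (n : nat) (w : 'I_n) : stopping_rule n :=
  fun t S => (w <= t)%N && is_record t S.

Definition random_threshold (R : realType) (n : nat) (n_gt0 : (0 < #|'I_n|)%N) :
    secretary_algorithm R n :=
  SecretaryAlgorithm (fdist_uniform R n_gt0) (@threshold_rule n).

Section Thresholds.
Variables (R : realType) (n : nat) (v : 'I_n -> R).

Lemma is_recordP (p : 'S_n) (i : 'I_n) :
  reflect (forall j, (p j < p i)%N -> v j < v i)
          (is_record (p i) (relative_order v p (p i))).
Proof.
apply: (iffP forallP) => [rec j ji|rec s].
  by have := rec (p j); rewrite ji inE /= !permK => /and3P[].
rewrite -[s](permKV p); apply/implyP => si.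
by rewrite inE /= leqnn (ltnW si) !permK rec.
Qed.

Lemma threshold_rule_succeeds (a b w : 'I_n) (p : 'S_n) : top_two v a b ->
  (p b < w <= p a)%N -> succeeds (threshold_rule w) v p.
Proof.
move=> top_ab /andP[bw wa]; apply/existsP; exists a.
apply/andP; split; last first.
  apply/forallP => j; case: (eqVneq j a) => [-> //|ja].
  exact: ltW (top_two_lt top_ab ja).
rewrite /selects /threshold_rule wa; apply/andP; split.
  apply/is_recordP => j ja; apply: top_two_lt top_ab _.
  by apply: contraTneq ja => ->; rewrite ltnn.
apply/forallP => s; rewrite -[s](permKV p); set j := (p^-1)%g s.
apply/implyP => ja; apply/negP => /andP[wj /is_recordP/(_ b (leq_trans bw wj))].
apply/negP; rewrite -leNgt; apply: top_ab.2.
by apply: contraTneq ja => ->; rewrite ltnn.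
Qed.

Lemma success_probability_random_threshold (mu : fdist R 'S_n)
    (n_gt0 : (0 < #|'I_n|)%N) (a b : 'I_n) : top_two v a b ->
  n%:R^-1 * \sum_z Pr mu (fun p => (p b < p z <= p a)%N)
    <= success_probability mu (random_threshold R n_gt0) v.
Proof.
move=> top_ab; rewrite /success_probability /=.
under [leRHS]eq_bigr do rewrite ffunE card_ord.
rewrite -mulr_sumr ler_wpM2l ?invr_ge0 ?ler0n //.
pose separates (p : 'S_n) (w : 'I_n) := (p b < w <= p a)%N.
rewrite -(sum_Pr_reindex mu separates (fun p => @perm_inj _ p)).
apply: ler_sum => w _; apply: le_Pr => p.
exact: threshold_rule_succeeds.
Qed.

End Thresholds.

Lemma random_threshold_guarantee (R : realType) (n : nat) (delta : R)
    (mu : fdist R 'S_n) (n_gt0 : (0 < #|'I_n|)%N) (v : 'I_n -> R) :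
  (3 <= n)%N -> uniform_induced_ordering 3 delta mu -> injective v ->
  n.+1%:R / n%:R * ((1 - delta) / 6%:R)
    <= success_probability mu (random_threshold R n_gt0) v.
Proof.
move=> n_ge3 hmu inj_v.
have [a [b top_ab]] : exists a b, top_two v a b.
  by apply: exists_top_two inj_v; rewrite card_ord ltnW.
have ab : a != b by apply: contraTneq top_ab.1 => ->; rewrite ltxx.
apply: le_trans (success_probability_random_threshold mu n_gt0 top_ab).
rewrite [_ / n%:R]mulrC -mulrA ler_wpM2l ?invr_ge0 ?ler0n //.
exact: sum_Pr_between.
Qed.

Theorem mainTheorem17 (R : realType) (n : nat) (hn : (3 <= n)%N) (delta : R)
    (hdelta0 : 0 <= delta) (hdelta1 : delta < 1) (mu : fdist R 'S_n)
    (hmu : uniform_induced_ordering 3 delta mu) :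
  exists A : secretary_algorithm R n,
    forall v : 'I_n -> R, injective v ->
      (1 - delta) ^+ 2 / (6%:R * (1 + delta)) <= success_probability mu A v.
Proof.
have n_gt0 : (0 < #|'I_n|)%N by rewrite card_ord (leq_trans _ hn).
exists (random_threshold R n_gt0) => v inj_v.
apply: le_trans (random_threshold_guarantee n_gt0 hn hmu inj_v).
have le_sixth : (1 - delta) ^+ 2 / (6%:R * (1 + delta)) <= (1 - delta) / 6%:R.
  by rewrite ler_pdivrMr; nra.
apply: le_trans le_sixth _; apply: ler_peMl.
  by rewrite divr_ge0 // subr_ge0 ltW.
by rewrite ler_pdivlMr ?mul1r ?ler_nat // ltr0n (leq_trans _ hn).
Qed.
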